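(* Let $f:\mathbb{R}^n\to\mathbb{R}^n$ be a twice continuously differentiable vector field. Let $F:\mathbb{R}^n\to\mathbb{R}^{n-m}$ be continuously differentiable with Jacobian $F_x(p)$ of rank $n-m$ at every $p\in\mathcal{M}:=F^{-1}(\mathbf{0})$, so that $\mathcal{M}$ is an $m$-dimensional embedded submanifold of $\mathbb{R}^n$ with global defining function $F$. Assume that $\mathcal{M}$ is invariant with respect to $\dot x=f(x)$. Let $\Omega\subset\mathbb{R}^n$ be a compact set such that $\mathcal{M}\cap\Omega$ is compact and non-empty, and for every $p\in\mathcal{M}\cap\Omega$ consider the matrix $$\Gamma(p)=F_x(p)\bigl(f_x(p)+f_x(p)^T\bigr)F_x(p)^T\in\mathbb{R}^{(n-m)\times(n-m)}.$$ Assume that $\Gamma(p)$ is positive definite for every $p\in\mathcal{M}\cap\Omega$. Then there exists $\epsilon^*>0$ such that, for every $\epsilon\in(0,\epsilon^*]$, the tubular $\epsilon$ neighbourhood $\mathcal{M}_\epsilon$ is overflowing invariant in $\Omega$.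
   Context: Here $f_x(p)$ and $F_x(p)$ denote the Jacobians of $f$ and $F$ at $x=p$. Let $\Phi(t,x_0)$ denote the flow of $\dot x=f(x)$, $x(0)=x_0$. A set $\mathcal{M}$ is invariant if $x_0\in\mathcal{M}$ implies $\Phi(t,x_0)\in\mathcal{M}$ for all $t\ge 0$. For $p\in\mathcal{M}$, $N_p\mathcal{M}$ is the normal space of $\mathcal{M}$ at $p$ (the orthogonal complement of the tangent space $T_p\mathcal{M}$ in $\mathbb{R}^n$ with the Euclidean inner product). The tubular $\epsilon$ neighbourhood of $\mathcal{M}$ is $\mathcal{M}_\epsilon=\{p+\bar\epsilon\, n_p : p\in\mathcal{M},\ n_p\in N_p\mathcal{M},\ \|n_p\|=1,\ \bar\epsilon\in(0,\epsilon)\}$, and its boundary is $\partial\mathcal{M}_\epsilon=\{p+\epsilon n_p : p\in\mathcal{M},\ n_p\in N_p\mathcal{M},\ \|n_p\|=1\}$. For $\epsilon>0$ and a set $\Omega$ with $\mathcal{M}\cap\Omega\neq\emptyset$, $\mathcal{M}_\epsilon$ is called overflowing invariant in $\Omega$ if for every $p\in\mathcal{M}\cap\Omega$ and every $n_p\in N_p\mathcal{M}$ with $\|n_p\|=1$ one has $\langle f(p+\epsilon n_p),n_p\rangle>0$ (the vector field points strictly outward at $p+\epsilon n_p$). *)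

(* Defs.v *)
From mathcomp Require Import all_boot all_order all_algebra.
From mathcomp Require Import all_classical all_reals all_analysis.
Import Order.TTheory GRing.Theory Num.Theory.
Import numFieldNormedType.Exports.

Set Implicit Arguments.
Unset Strict Implicit.
Unset Printing Implicit Defensive.

Local Open Scope classical_set_scope.
Local Open Scope ring_scope.

(* Points of R^n are row vectors ['rV[R]_n]. The library norm on ['rV[R]_n] is
   the sup norm, so the Euclidean structure is introduced here; topology and
   differentiability do not depend on this choice. *)

Definition dot (R : realType) (n : nat) (u v : 'rV[R]_n) : R :=
  \sum_(i < n) u 0 i * v 0 i.

Definition enorm (R : realType) (n : nat) (u : 'rV[R]_n) : R :=
  Num.sqrt (dot u u).

(* ['J f p] acts on row vectors from the right, [('J f p) i j] being the i-th
   partial derivative of the j-th component. The transpose is the Jacobian in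
   the usual convention: [Jac f p i j] is the j-th partial of the i-th
   component. *)
Definition Jac (R : realType) (n k : nat) (f : 'rV[R]_n -> 'rV[R]_k)
    (p : 'rV[R]_n) : 'M[R]_(k, n) :=
  ('J f p)^T.

Definition C1 (R : realType) (n k : nat) (f : 'rV[R]_n -> 'rV[R]_k) : Prop :=
  (forall p, differentiable f p) /\ continuous (Jac f).

(* [mxvec] lists the entries of the Jacobian as a vector, so the second
   conjunct says that every first-order partial derivative is C1. *)
Definition C2 (R : realType) (n k : nat) (f : 'rV[R]_n -> 'rV[R]_k) : Prop :=
  C1 f /\ C1 (fun p => mxvec (Jac f p)).

(* Graph of the (in general only locally defined) flow Phi of x' = f(x):
   [flow f t x0 y] means that the solution with x(0) = x0 exists on an open
   interval containing 0 and t, and takes the value y at time t. *)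
Definition flow (R : realType) (n : nat) (f : 'rV[R]_n -> 'rV[R]_n)
    (t : R) (x0 y : 'rV[R]_n) : Prop :=
  exists (a b : R) (x : R -> 'rV[R]_n),
    [/\ a < 0 < b, a < t < b,
        (forall s : R, a < s < b -> is_derive s 1 x (f (x s))),
        x 0 = x0 & x t = y].

(* No forward completeness is required: the condition concerns all t >= 0 for
   which Phi(t, x0) is defined. *)
Definition invariant_set (R : realType) (n : nat) (f : 'rV[R]_n -> 'rV[R]_n)
    (M : set 'rV[R]_n) : Prop :=
  forall x0, M x0 -> forall (t : R) y, 0 <= t -> flow f t x0 y -> M y.

(* Velocities at p of curves in M through p. *)
Definition tangent_space (R : realType) (n : nat) (M : set 'rV[R]_n)
    (p : 'rV[R]_n) : set 'rV[R]_n :=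
  [set v | exists c : R -> 'rV[R]_n,
     [/\ c 0 = p, (\forall t \near (0 : R), M (c t)) & is_derive (0 : R) 1 c v]].

Definition normal_space (R : realType) (n : nat) (M : set 'rV[R]_n)
    (p : 'rV[R]_n) : set 'rV[R]_n :=
  [set u | forall v, tangent_space M p v -> dot u v = 0].

(* The points p + eps u below are those of the boundary of the tubular eps
   neighbourhood of M that are based at p in M `&` Omega. *)
Definition overflowing_invariant (R : realType) (n : nat)
    (f : 'rV[R]_n -> 'rV[R]_n) (M Omega : set 'rV[R]_n) (eps : R) : Prop :=
  forall p, (M `&` Omega) p ->
  forall u, normal_space M p u -> enorm u = 1 ->
    0 < dot (f (p + eps *: u)) u.

Definition Gamma (R : realType) (n k : nat) (f : 'rV[R]_n -> 'rV[R]_n)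
    (F : 'rV[R]_n -> 'rV[R]_k) (p : 'rV[R]_n) : 'M[R]_k :=
  Jac F p *m (Jac f p + (Jac f p)^T) *m (Jac F p)^T.

Definition posdefmx (R : realType) (k : nat) (A : 'M[R]_k) : Prop :=
  A^T = A /\ forall w : 'rV[R]_k, w != 0 -> 0 < (w *m A *m w^T) 0 0.

(* Main.v *)
Require Import Defs.
From HB Require Import structures.
From mathcomp Require Import all_boot all_order all_algebra.
From mathcomp Require Import all_classical all_reals all_analysis.
From mathcomp Require Import ring lra.
Import Order.TTheory GRing.Theory Num.Theory.
Import numFieldNormedType.Exports.
Local Open Scope classical_set_scope.
Local Open Scope ring_scope.

Set Implicit Arguments.
Unset Strict Implicit.
Unset Printing Implicit Defensive.

(* Every vector of ker F_x(p) is the velocity at p of a curve in M (the part of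
   the implicit function theorem that is needed), hence a normal vector u at p
   has the form F_x(p)^T w. A local solution through p (Picard-Lindelof) stays
   in M for t >= 0, so F_x(p) f(p) = 0 and <f(p), u> = 0. The mean value theorem
   then gives <f(p + eps u), u> = eps <f_x(p + c u) u, u> with 0 < c < eps.
   At c = 0 the right-hand pairing is w^T Gamma(p) w / 2 > 0; by compactness of
   (M cap Omega) x (unit sphere of the w) it stays positive for all c small
   enough, uniformly in p and w, the sign being invariant under scaling w. *)

(* The library's uniform completeness of matrices predates their norm; restating
   it here makes them a completeNormedModType. *)
HB.instance Definition _ (R : realType) m n := Complete.on 'M[R]_(m, n).

(** * Matrix norm estimates, entrywise limits and derivatives *)

Lemma ler_mx_norm (R : realType) m n (A : 'M[R]_(m, n)) (c : R) :
  0 <= c -> (forall i j, `|A i j| <= c) -> `|A| <= c.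
Proof.
move=> c0 Ac; rewrite [leLHS]/Num.Def.normr/= mx_normrE.
by apply/bigmax_leP; split => // i _; exact: Ac.
Qed.

Lemma ler_norm_coord (R : realType) m n (A : 'M[R]_(m, n)) i j : `|A i j| <= `|A|.
Proof.
rewrite [leRHS]/Num.Def.normr/= mx_normrE.
exact: (le_bigmax _ (fun k : 'I_m * 'I_n => `|A k.1 k.2|) (i, j)).
Qed.

Lemma ler_norm_mulmx (R : realType) m n k (A : 'M[R]_(m, n)) (B : 'M[R]_(n, k)) :
  `|A *m B| <= n%:R * `|A| * `|B|.
Proof.
apply: ler_mx_norm => [|i j]; first by rewrite !mulr_ge0.
rewrite mxE (le_trans (ler_norm_sum _ _ _))//.
rewrite -mulrA -[n in n%:R]card_ord mulr_natl -sumr_const ler_sum// => l _.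
by rewrite normrM ler_pM// ler_norm_coord.
Qed.

Lemma cvg_mxP (R : realType) m n (T : Type) (F : set_system T) {FF : Filter F}
    (f : T -> 'M[R]_(m, n)) (A : 'M[R]_(m, n)) :
  (forall i j, f x i j @[x --> F] --> A i j) -> f x @[x --> F] --> A.
Proof.
move=> fA; apply/cvgrPdist_le => e e0.
have : \forall x \near F, forall i : 'I_m * 'I_n, `|A i.1 i.2 - f x i.1 i.2| <= e.
  apply: filter_forall => i; move/cvgrPdist_le : (fA i.1 i.2).
  exact.
apply: filterS => x Ax; apply: ler_mx_norm => [|i j]; first exact: ltW.
by have := Ax (i, j); rewrite !mxE.
Qed.

Lemma cvg_coord (R : realType) m n (T : Type) (F : set_system T) {FF : Filter F}
    (f : T -> 'M[R]_(m, n)) (A : 'M[R]_(m, n)) i j :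
  f x @[x --> F] --> A -> f x i j @[x --> F] --> A i j.
Proof. by move=> fA; exact: (continuous_cvg _ (@coord_continuous _ _ _ i j A) fA). Qed.

Lemma cvg_mulmx (R : realType) m n k (T : Type) (F : set_system T) {FF : Filter F}
    (f : T -> 'M[R]_(m, n)) (g : T -> 'M[R]_(n, k)) (A : 'M[R]_(m, n)) (B : 'M[R]_(n, k)) :
  f x @[x --> F] --> A -> g x @[x --> F] --> B ->
  (f x *m g x) @[x --> F] --> A *m B.
Proof.
move=> fA gB; apply: cvg_mxP => i j.
rewrite [X in X @ _ --> _](_ : _ = fun x => \sum_l f x i l * g x l j); last first.
  by apply/funext => x; rewrite mxE.
rewrite mxE; apply: cvg_big => [|l _]; first exact: add_continuous.
by apply: cvgM; exact: cvg_coord.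
Qed.

Lemma cvg_trmx (R : realType) m n (T : Type) (F : set_system T) {FF : Filter F}
    (f : T -> 'M[R]_(m, n)) (A : 'M[R]_(m, n)) :
  f x @[x --> F] --> A -> (f x)^T @[x --> F] --> A^T.
Proof.
move=> fA; apply: cvg_mxP => i j.
rewrite [X in X @ _ --> _](_ : _ = fun x => f x j i); last first.
  by apply/funext => x; rewrite mxE.
by rewrite mxE; exact: cvg_coord.
Qed.

Lemma is_derive_coord (R : realType) m n (g : R -> 'M[R]_(m, n)) (t : R) (dg : 'M[R]_(m, n)) i j :
  is_derive t 1 g dg -> is_derive t 1 (fun s => g s i j) (dg i j).
Proof.
move=> [dv dgE]; split; first by move/derivable_mxP : dv.
by rewrite -dgE derive_mx// mxE.
Qed.

Lemma is_derive_mx (R : realType) m n (g : R -> 'M[R]_(m, n)) (t : R) (dg : 'M[R]_(m, n)) :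
  (forall i j, is_derive t 1 (fun s => g s i j) (dg i j)) -> is_derive t 1 g dg.
Proof.
move=> H.
have dv : derivable g t 1 by apply/derivable_mxP => i j; case: (H i j).
split => //; rewrite derive_mx//; apply/matrixP => i j; rewrite mxE.
by case: (H i j).
Qed.

Lemma is_derive_mulmxr (R : realType) m n k (g : R -> 'M[R]_(m, n)) (t : R)
    (dg : 'M[R]_(m, n)) (B : 'M[R]_(n, k)) :
  is_derive t 1 g dg -> is_derive t 1 (fun s => g s *m B) (dg *m B).
Proof.
move=> gdg; apply: is_derive_mx => i j; rewrite mxE.
have -> : (fun s => (g s *m B) i j) = \sum_l (B l j \*: (fun s => g s i l)).
  apply/funext => s; rewrite mxE fct_sumE; apply: eq_bigr => l _.
  by rewrite mulrC.
have -> : \sum_l dg i l * B l j = \sum_l (B l j *: (dg i l : R^o)).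
  by apply: eq_bigr => l _; exact: mulrC.
by apply: is_derive_sum => l; apply: is_deriveZ; exact: is_derive_coord.
Qed.

Lemma is_derive_continuous (R : realType) (g : R -> R) (t dg : R) :
  is_derive t 1 g dg -> {for t, continuous g}.
Proof. by move=> [/derivable1_diffP/differentiable_continuous]. Qed.

(** * Mean value inequality and strict differentiability of C1 maps *)

Lemma mean_value_ineq (R : realType) m n (g dg : R -> 'M[R]_(m, n)) (a b C : R) :
  a <= b -> (forall t, a <= t <= b -> is_derive t 1 g (dg t)) ->
  (forall t, a <= t <= b -> `|dg t| <= C) ->
  `|g b - g a| <= C * (b - a).
Proof.
move=> ab gdg dgC.
have C0 : 0 <= C by apply: le_trans (dgC a _); rewrite ?lexx.
apply: ler_mx_norm => [|i j]; first by rewrite mulr_ge0// subr_ge0.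
(* The intermediate point depends on the entry [(i, j)]; this is harmless because the matrix norm is
   the maximum of the entries. *)
have [t||c cab E] := @MVT_segment _ (fun s => g s i j) (fun s => dg s i j) _ _ ab.
- by rewrite in_itv/= => /andP[ta tb]; apply: is_derive_coord; apply: gdg; rewrite !ltW.
- apply: continuous_in_subspaceT => t; rewrite inE/= in_itv/= => tab.
  by apply: is_derive_continuous; apply: is_derive_coord; exact: gdg.
rewrite !mxE E normrM (ger0_norm (_ : 0 <= b - a)) ?subr_ge0//.
rewrite ler_wpM2r ?subr_ge0// (le_trans (ler_norm_coord _ _ _))//.
by apply: dgC; rewrite in_itv/= in cab.
Qed.

Lemma is_derive_line (R : realType) n k (F : 'rV[R]_n -> 'rV[R]_k) (y d : 'rV[R]_n)
    (t : R) : differentiable F (y + t *: d) ->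
  is_derive t 1 (fun s => F (y + s *: d)) (d *m 'J F (y + t *: d)).
Proof.
move=> dF.
have E : (fun h : R => h^-1 *: (F (y + (h *: (1 : R) + t) *: d) - F (y + t *: d))) =
         (fun h : R => h^-1 *: (F (h *: d + (y + t *: d)) - F (y + t *: d))).
  apply/funext => h; congr (_ *: (F _ - _)).
  by rewrite [h *: 1]mulr1 scalerDl addrCA.
split.
  by rewrite /derivable E; exact: diff_derivable.
by have <- := deriveEjacobian d dF; rewrite /derive E.
Qed.

Lemma is_derive_scalel (R : realType) (V : normedModType R) (v : V) (t : R) :
  is_derive t 1 (fun s : R => s *: v) v.
Proof.
split; first by apply/derivable1_diffP.
by rewrite deriveE// diff_val scale1r.
Qed.

Lemma C1_continuous_jacobian (R : realType) n k (F : 'rV[R]_n -> 'rV[R]_k) :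
  C1 F -> continuous (fun q => 'J F q).
Proof.
move=> [_ cJ] p.
have E : (fun q => 'J F q) = (fun q => (Jac F q)^T).
  by apply/funext => q; rewrite /Jac trmxK.
by rewrite E; exact: (cvg_trmx (f := Jac F) (cJ p)).
Qed.

(** Along the segment from [y] to [x], the derivative of [F] minus its linear part at [p] is
    [(x - y)] times a difference of Jacobians. That difference is small near [p], so the mean value
    inequality applies. *)
Lemma C1_strict_differentiable (R : realType) n k (F : 'rV[R]_n -> 'rV[R]_k) p (e : R) :
  C1 F -> 0 < e -> exists2 d : R, 0 < d & forall x y, `|x - p| <= d -> `|y - p| <= d ->
    `|F x - F y - (x - y) *m 'J F p| <= e * `|x - y|.
Proof.
move=> C1F e0; have [dF _] := C1F; have n0 : 0 < n%:R + 1 :> R by rewrite ltr_wpDl.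
(* The bound on a matrix product costs a factor [n]; dividing by [n + 1] also covers [n = 0]. *)
have e'0 : 0 < e / (n%:R + 1) by rewrite divr_gt0.
have /cvgrPdist_le/(_ _ e'0)/nbhs_ballP[r /= r0 rP] := C1_continuous_jacobian C1F (x := p).
have r20 : 0 < r / 2 by rewrite divr_gt0.
exists (r / 2) => // x y xp yp.
pose g (t : R) := F (y + t *: (x - y)) - t *: ((x - y) *m 'J F p).
pose dg (t : R) := (x - y) *m 'J F (y + t *: (x - y)) - (x - y) *m 'J F p.
have := @mean_value_ineq R 1 k g dg 0 1 (e * `|x - y|) ler01.
rewrite /g scale1r scale0r addr0 scale1r scale0r subr0 addrAC subr0 mulr1.
rewrite [y + (x - y)]addrC subrK; apply.
- move=> t t01; apply: is_deriveB; first by apply: is_derive_line; exact: dF.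
  exact: is_derive_scalel.
- move=> t /andP[t0 t1]; rewrite /dg -mulmxBr (le_trans (ler_norm_mulmx _ _))//.
  rewrite mulrAC mulrC [e * _]mulrC; apply: ler_wpM2l => //.
  set B := 'J F (y + _) - _; have Je : `|B| <= e / (n%:R + 1).
    rewrite /B -normrN opprB; apply: rP; rewrite -ball_normE/=.
    (* Points of the segment are convex combinations, hence within [r / 2] of [p] and so in the open
       ball of radius [r]. *)
    have -> : p - (y + t *: (x - y)) = - ((1 - t) *: (y - p) + t *: (x - p)).
      apply/rowP => i; rewrite !mxE; ring.
    rewrite normrN (le_lt_trans (ler_normD _ _))// !normrZ.
    rewrite (ger0_norm t0) (ger0_norm (_ : 0 <= 1 - t)) ?subr_ge0//.
    have : (1 - t) * `|y - p| <= (1 - t) * (r / 2) by rewrite ler_wpM2l// subr_ge0.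
    have : t * `|x - p| <= t * (r / 2) by rewrite ler_wpM2l.
    lra.
  apply: (@le_trans _ _ (n%:R * (e / (n%:R + 1)))); first by rewrite ler_wpM2l.
  rewrite mulrCA ler_piMr ?(ltW e0)// ler_pdivrMr// mul1r; lra.
Qed.

(** * Tangent vectors of a level set *)

(* A zero of F on the affine space q + im D is a fixed point of
   w |-> w - F (q + w D), a contraction of ratio 1/2 for q near p. *)
Lemma local_zero (R : realType) n k (F : 'rV[R]_n -> 'rV[R]_k) p (D : 'M[R]_(k, n)) :
  C1 F -> D *m 'J F p = 1%:M ->
  exists2 d : R, 0 < d & forall q, `|q - p| <= d -> `|F q| <= d ->
    exists2 w : 'rV[R]_k, `|w| <= 2 * `|F q| & F (q + w *m D) = 0.
Proof.
move=> C1F DJ; pose c := k%:R * `|D|.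
have c0 : 0 <= c by rewrite mulr_ge0.
have wD (w : 'rV[R]_k) : `|w *m D| <= c * `|w|.
  by rewrite (le_trans (ler_norm_mulmx _ _))// mulrAC.
(* Chosen so that [c / (2 * (c + 1)) <= 1/2], the contraction ratio. *)
have e0 : 0 < (2 * (c + 1))^-1 by rewrite invr_gt0; lra.
have [r r0 rF] := C1_strict_differentiable p C1F e0.
(* With [|q - p|] and [|F q|] below this radius, [|q - p| + c * (2 * |F q|) <= r]. *)
have d0 : 0 < r / (1 + 2 * c) by rewrite divr_gt0//; lra.
exists (r / (1 + 2 * c)) => // q qp Fq.
pose U := [set w : 'rV[R]_k | `|w| <= 2 * `|F q|].
have Ur w : U w -> `|q + w *m D - p| <= r.
  rewrite /U/= => Uw; rewrite addrAC (le_trans (ler_normD _ _))//.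
  have h1 := wD w.
  have h2 : c * `|w| <= c * (2 * (r / (1 + 2 * c))).
    by rewrite ler_wpM2l// (le_trans Uw)// ler_wpM2l.
  have -> : r = r / (1 + 2 * c) + c * (2 * (r / (1 + 2 * c))).
    by field; apply: lt0r_neq0; lra.
  by rewrite lerD// (le_trans h1).
pose g (w : 'rV[R]_k) := w - F (q + w *m D).
have gL w w' : U w -> U w' -> `|g w - g w'| <= 2^-1 * `|w - w'|.
  move=> Uw Uw'.
  have := rF _ _ (Ur _ Uw) (Ur _ Uw').
  have E : q + w *m D - (q + w' *m D) = (w - w') *m D.
    by rewrite mulmxBl opprD addrACA subrr add0r.
  rewrite E -mulmxA DJ mulmx1 => h.
  have -> : g w - g w' = - (F (q + w *m D) - F (q + w' *m D) - (w - w')).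
    by rewrite /g; apply/rowP => i; rewrite !mxE; ring.
  rewrite normrN (le_trans h)//.
  apply: (@le_trans _ _ ((2 * (c + 1))^-1 * (c * `|w - w'|))).
    by rewrite ler_wpM2l ?(ltW e0).
  rewrite mulrA ler_wpM2r// invfM -mulrA ler_piMr ?invr_ge0//.
  rewrite mulrC ler_pdivrMr; lra.
have g0 : g 0 = - F q by rewrite /g mul0mx addr0 sub0r.
have U0 : U 0 by rewrite /U/= normr0 mulr_ge0.
have gU : {homo g : w / U w >-> U w}.
  move=> w Uw; rewrite /U/= -[g w](subrK (g 0)) (le_trans (ler_normD _ _))//.
  have := gL _ _ Uw U0; rewrite subr0 g0 normrN.
  move: Uw; rewrite /U/=; lra.
have clU : closed U.
  have -> : U = closed_ball_ Num.norm 0 (2 * `|F q|).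
    by apply/funext => w; rewrite /U /closed_ball_/= sub0r normrN.
  exact: closed_closed_ball_.
have cg : is_contraction (mkfun_fun gU).
  exists (2^-1)%:nng; split; first by rewrite /=; lra.
  by move=> [w w'] /= [Uw Uw']; exact: gL.
have [] := banach_fixed_point cg clU; first by exists 0.
move=> w Uw wE; exists w => //.
have : w = g w by exact: wE.
by rewrite /g => /eqP; rewrite -subr_eq0 opprB addrCA subrr addr0 => /eqP.
Qed.

Lemma is_derive0P (R : realType) n (c : R -> 'rV[R]_n) v :
  (forall e, 0 < e -> exists2 d : R, 0 < d & forall h, `|h| <= d ->
     `|c h - c 0 - h *: v| <= e * `|h|) -> is_derive (0 : R) 1 c v.
Proof.
move=> H.
have cv : h^-1 *: (c (h *: (1 : R) + 0) - c 0) @[h --> (0 : R)^'] --> v.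
  apply/cvgrPdist_le => e e0; have [d d0 dP] := H _ e0.
  near=> h.
  have h0 : h != 0 by near: h; exact: nbhs_dnbhs_neq.
  have hd : `|h| <= d by near: h; exact: dnbhs0_le.
  have -> : v - h^-1 *: (c (h *: (1 : R) + 0) - c 0) = - (h^-1 *: (c h - c 0 - h *: v)).
    rewrite [h *: 1]mulr1 addr0 [in RHS]scalerBr scalerA mulVf// scale1r opprB.
    by [].
  rewrite normrN normrZ normfV ler_pdivrMl ?normr_gt0// mulrC.
  exact: dP.
split; first by apply/cvg_ex; exists v.
exact/cvg_lim.
Unshelve. all: by end_near. Qed.

(** The line [p + t v] leaves the level set only to order [o(t)], because [v] is in the kernel.
    [local_zero] moves it back by a correction of size at most a constant times [|F (p + t v)|],
    again [o(t)], so the corrected curve still has velocity [v] at 0. *)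
Lemma ker_jacobian_tangent (R : realType) n k (F : 'rV[R]_n -> 'rV[R]_k) p v
    (D : 'M[R]_(k, n)) :
  C1 F -> D *m 'J F p = 1%:M -> F p = 0 -> v *m 'J F p = 0 ->
  tangent_space (F @^-1` [set 0]) p v.
Proof.
move=> C1F DJ Fp vJ.
have [d d0 dP] := local_zero C1F DJ.
have Fo (e : R) : 0 < e -> exists2 b : R, 0 < b & forall t : R, `|t| <= b ->
    `|F (p + t *: v)| <= e * `|t|.
  move=> e0; have v0 : 0 < `|v| + 1 by rewrite ltr_wpDl.
  have [r r0 rF] := C1_strict_differentiable p C1F (divr_gt0 e0 v0).
  exists (r / (`|v| + 1)); first by rewrite divr_gt0.
  move=> t tr; have := rF (p + t *: v) p.
  rewrite addrC addKr subrr normr0 normrZ Fp subr0 -scalemxAl vJ scaler0 subr0 addrC.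
  have tv : `|t| * `|v| <= r.
    rewrite ler_pdivlMr// in tr; apply: le_trans tr.
    by rewrite ler_wpM2l// lerDl.
  move=> /(_ tv (ltW r0)) h; rewrite (le_trans h)//.
  rewrite mulrCA [leRHS]mulrC ler_wpM2l// -mulrA ler_piMr ?(ltW e0)//.
  rewrite mulrC ler_pdivrMr//; lra.
pose W t := [set w : 'rV[R]_k | `|w| <= 2 * `|F (p + t *: v)| /\
                                F (p + t *: v + w *m D) = 0].
pose w t := xget 0 (W t).
have [b b0 bP] := Fo 1 ltr01.
have v0 : 0 < `|v| + 1 by rewrite ltr_wpDl.
(* For [|t| <= a] both conditions of [local_zero] hold: [|t v| <= d], and
   [|F (p + t v)| <= |t| <= d] by the bound with constant 1. *)
pose a := Num.min b (Num.min d (d / (`|v| + 1))).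
have a0 : 0 < a by rewrite !lt_min b0 d0 divr_gt0.
have Ww t : `|t| <= a -> W t (w t).
  rewrite !le_min => /and3P[tb td tv].
  have [||x xF x0] := dP (p + t *: v); last by exact: (xgetI 0 (conj xF x0)).
    rewrite addrC addKr normrZ.
    rewrite ler_pdivlMr// in tv; apply: le_trans tv.
    by rewrite ler_wpM2l// lerDl.
  by rewrite (le_trans (bP _ tb))// mul1r.
have w0 : w 0 = 0.
  have [|+ _] := Ww 0; first by rewrite normr0 ltW.
  by rewrite scale0r addr0 Fp normr0 mulr0 normr_le0 => /eqP.
exists (fun t => p + t *: v + w t *m D); split.
- by rewrite w0 mul0mx scale0r !addr0.
- have na : \forall t \near (0 : R), `|t| <= a by exact: nbhs0_le.
  by apply: filterS na => t /Ww[].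
- apply: is_derive0P => e e0.
  pose c := k%:R * `|D|.
  have c0 : 0 <= c by rewrite mulr_ge0.
  have e'0 : 0 < e / (2 * (c + 1)) by rewrite divr_gt0//; lra.
  have [r r0 rP] := Fo _ e'0.
  exists (Num.min r a); first by rewrite lt_min r0 a0.
  move=> h; rewrite le_min => /andP[hr ha].
  rewrite w0 mul0mx scale0r !addr0.
  have -> : p + h *: v + w h *m D - p - h *: v = w h *m D.
    by apply/rowP => i; rewrite !mxE; ring.
  rewrite (le_trans (ler_norm_mulmx _ _))//.
  have [wF _] := Ww _ ha.
  rewrite mulrAC -/c.
  apply: (@le_trans _ _ (c * (2 * (e / (2 * (c + 1)) * `|h|)))).
    by rewrite ler_wpM2l// (le_trans wF)// ler_wpM2l// rP.
  have -> : c * (2 * (e / (2 * (c + 1)) * `|h|)) = (c / (c + 1)) * (e * `|h|).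
    by field; apply: lt0r_neq0; lra.
  rewrite ler_piMl ?mulr_ge0 ?(ltW e0)// ler_pdivrMr; lra.
Unshelve. all: by end_near. Qed.

(** * Local solutions of autonomous differential equations *)

Lemma exists_primitive (R : realType) m n (g : R -> 'M[R]_(m, n)) :
  continuous g -> exists G : R -> 'M[R]_(m, n),
    G 0 = 0 /\ forall t : R, -1 < t < 1 -> is_derive t 1 G (g t).
Proof.
move=> cg.
have sc (i : 'I_m * 'I_n) : exists G : R -> R,
    G 0 = 0 /\ forall t : R, -1 < t < 1 -> is_derive t 1 G (g t i.1 i.2).
  pose h (t : R) : R := g t i.1 i.2.
  have ch : continuous h by move=> t; exact: (@cvg_coord R m n R (nbhs t) _ g (g t) i.1 i.2 (cg t)).
  (* Integrating from -1 makes 0 and negative times interior points for the fundamental theorem of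
     calculus; subtracting [H 0] then normalises the primitive. *)
  pose H (t : R) := (\int[lebesgue_measure]_(s in `[-1, t]) h s)%R.
  exists (fun t => H t - H 0); split; first by rewrite subrr.
  move=> t /andP[t1 t2].
  have ih : lebesgue_measure.-integrable `[-1, 1] (EFin \o h).
    apply: continuous_compact_integrable; first exact: segment_compact.
    exact: continuous_subspaceT.
  have [dH HE] := continuous_FTC1_closed t2 ih t1 (ch t).
  rewrite -[g t _ _]subr0; apply: is_deriveB.
  by split; [exact: dH|exact: (etrans (esym (derive1E H t)) HE)].
have [G GP] := choice sc.
exists (fun t => \matrix_(i, j) G (i, j) t); split.
  by apply/matrixP => i j; rewrite !mxE (GP (i, j)).1.
move=> t t1; apply: is_derive_mx => i j.
under eq_fun do rewrite mxE.
exact: (GP (i, j)).2.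
Qed.

Lemma exists_geometric_limit (R : realType) (V : completeNormedModType R)
    (u : nat -> V) (C : R) :
  (forall k, `|u k.+1 - u k| <= C * 2^-1 ^+ k) ->
  exists l, forall k, `|u k - l| <= 2 * C * 2^-1 ^+ k.
Proof.
move=> uC.
have C0 : 0 <= C by have := uC 0; rewrite expr0 mulr1; apply: le_trans.
have q1 : `|2^-1 : R| < 1 by rewrite ger0_norm; lra.
have cu : cvgn u.
  have : cvgn (series (telescope u)).
    apply: normed_cvg.
    apply: (@series_le_cvg _ _ (geometric C 2^-1)) => [k|k|k|].
    - exact: normr_ge0.
    - by rewrite /geometric/= mulr_ge0// exprn_ge0//; lra.
    - exact: uC.
    - exact: is_cvg_geometric_series.
  move=> /cvg_ex[l lP]; apply/cvg_ex; exists (l + u 0%N).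
  have E : u = series (telescope u) + cst (u 0%N).
    by apply/funext => k; rewrite telescopeK/= !fctE subrK.
  by rewrite [X in X @ _ --> _]E; exact: (cvgD lP (cvg_cst _)).
(* The factor [1 - 2^-j] is the exact partial geometric sum, which lets the induction on [j]
   close. *)
have uk k j : `|u k - u (k + j)%N| <= 2 * C * 2^-1 ^+ k * (1 - 2^-1 ^+ j).
  elim: j => [|j IH]; first by rewrite addn0 subrr normr0 expr0 subrr mulr0.
  rewrite -(subrKA (u (k + j)%N)) (le_trans (ler_normD _ _))//.
  rewrite (le_trans (lerD IH (_ : _ <= C * 2^-1 ^+ (k + j))))//.
    by rewrite addnS distrC uC.
  rewrite exprD exprS; lra.
exists (limn u) => k.
have cl := @closed_closed_ball_ R V (u k) (2 * C * 2^-1 ^+ k).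
suff : closed_ball_ Num.norm (u k) (2 * C * 2^-1 ^+ k) (limn u) by [].
apply: (closed_cvg _ cl _ _ cu).
exists k => // j /= kj; rewrite /closed_ball_/=.
rewrite -(subnKC kj) (le_trans (uk _ _))// ler_piMr//.
  by rewrite !mulr_ge0// exprn_ge0//; lra.
Qed.

(** Serves to pass estimates on the Picard iterates to their limit. *)
Lemma le_geometric (R : realType) (a b c : R) :
  (forall k, a <= b + c * 2^-1 ^+ k) -> a <= b.
Proof.
move=> H; have q1 : `|2^-1 : R| < 1 by rewrite ger0_norm; lra.
have : (b + geometric c 2^-1 k) @[k --> \oo] --> b + 0.
  by apply: cvgD; [exact: cvg_cst|exact: cvg_geometric].
rewrite addr0 => /cvgr_to_ge; apply.
by apply: nearW => k; exact: H.
Qed.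

Lemma lipschitz_continuous (R : realType) (V : normedModType R) (g : R -> V) (K : R) :
  (forall s t, `|g s - g t| <= K * `|s - t|) -> continuous g.
Proof.
move=> gK t; apply/cvgrPdist_le => e e0.
have K0 : 0 < `|K| + 1 by rewrite ltr_wpDl.
near=> s.
have st : `|t - s| <= e / (`|K| + 1).
  by near: s; move/cvgrPdist_le : (@cvg_id _ (nbhs t)); apply; rewrite divr_gt0.
rewrite (le_trans (gK _ _))//; rewrite ler_pdivlMr// mulrC in st.
rewrite (le_trans _ st)// ler_wpM2r//.
by rewrite (le_trans (ler_norm K))// lerDl.
Unshelve. all: by end_near. Qed.

Lemma mean_value_dist (R : realType) m n (G g : R -> 'M[R]_(m, n)) (I : interval R) (C a b : R) :
  (forall t, t \in I -> is_derive t 1 G (g t)) -> (forall t, t \in I -> `|g t| <= C) ->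
  a \in I -> b \in I -> `|G b - G a| <= C * `|b - a|.
Proof.
wlog ab : a b / a <= b => [H dG gC aI bI|].
  have /orP[] := le_total a b => ab; first exact: H.
  by rewrite distrC [`|b - a|]distrC; exact: H.
move=> dG gC aI bI.
have sub t : a <= t <= b -> t \in I.
  by move=> tab; apply: (interval_is_interval aI bI).
rewrite (ger0_norm (_ : 0 <= b - a)) ?subr_ge0//.
by apply: (mean_value_ineq (dg := g)) => // t /sub; [exact: dG|exact: gC].
Qed.

(* Primitive on (-1, 1) vanishing at 0 when g is continuous; for other g it may
   be the zero function. *)
Definition primitive (R : realType) n (g : R -> 'rV[R]_n) : R -> 'rV[R]_n :=
  xget (fun=> 0) [set G | G 0 = 0 /\ forall t : R, -1 < t < 1 -> is_derive t 1 G (g t)].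

Lemma primitiveP (R : realType) n (g : R -> 'rV[R]_n) : continuous g ->
  primitive g 0 = 0 /\
  forall t : R, t \in `]-1, 1[ -> is_derive t 1 (primitive g) (g t).
Proof.
move=> /exists_primitive[G GP].
have [P0 P1] : [set G : R -> 'rV[R]_n |
    G 0 = 0 /\ forall t : R, -1 < t < 1 -> is_derive t 1 G (g t)] (primitive g).
  by apply: xgetPex; exists G.
by split => // t; rewrite in_itv/=; exact: P1.
Qed.

Lemma clamp_dist (R : realFieldType) (T s t : R) :
  `|Num.max (- T) (Num.min T s) - Num.max (- T) (Num.min T t)| <= `|s - t|.
Proof.
rewrite /Order.max /Order.min.
case: (ltP T s) => ?; case: (ltP T t) => ?;
  repeat (case: ifPn; rewrite -?leNgt => ?); rewrite ?subrr ?normr0//;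
  rewrite ler_norml; have := ler_norm (s - t); have := ler_norm (t - s);
  rewrite (distrC t s) => ? ?; apply/andP; split; lra.
Qed.

(* Clamping time to [-T, T] makes the Picard iterates total functions on R, so
   that no space of functions on a compact interval is needed. *)
Lemma picard_lindelof (R : realType) n (f : 'rV[R]_n -> 'rV[R]_n) p (r L : R) :
  0 < r -> 0 <= L ->
  (forall x y, `|x - p| <= r -> `|y - p| <= r -> `|f x - f y| <= L * `|x - y|) ->
  exists (T : R) (x : R -> 'rV[R]_n), [/\ 0 < T, x 0 = p &
    forall s, - T < s < T -> is_derive s 1 x (f (x s))].
Proof.
move=> r0 L0 fL; pose K := `|f p| + L * r.
have K0 : 0 <= K by rewrite addr_ge0// mulr_ge0// ltW.
have fK x : `|x - p| <= r -> `|f x| <= K.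
  move=> xp; rewrite -[f x](subrK (f p)) (le_trans (ler_normD _ _))// addrC lerD//.
  by rewrite (le_trans (fL _ _ _ _))// ?subrr ?normr0 ?(ltW r0)// ler_wpM2l.
(* The three bounds keep clamped times inside []-1, 1[], where [primitive] is a genuine primitive,
   keep the iterates within [r] of [p], and make the Picard map contract by 1/2. *)
pose T : R := Num.min 2^-1 (Num.min (r / (K + 1)) (2 * (L + 1))^-1).
have T0 : 0 < T by rewrite !lt_min invr_gt0 divr_gt0 ?invr_gt0//; lra.
have [T1 TK TL] : [/\ T <= 2^-1, T <= r / (K + 1) & T <= (2 * (L + 1))^-1].
  by rewrite /T; split; rewrite !ge_min lexx ?orbT.
pose cl t := Num.max (- T) (Num.min T t).
have clT t : `|cl t| <= T.
  by rewrite ler_norml /cl le_max lexx/= ge_max ge_min lexx andbT; lra.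
have clI t : cl t \in `]-1, 1[.
  by have := clT t; rewrite ler_norml in_itv/= => /andP[? ?]; lra.
have cl_id t : - T < t < T -> cl t = t.
  by move=> /andP[a b]; rewrite /cl min_r ?max_r// ltW.
have cl0 : cl 0 = 0 by rewrite cl_id// oppr_lt0 T0.
(* This class is stable under the Picard map and under pointwise limits; the Lipschitz condition
   makes [f \o y] continuous, as [primitiveP] requires. *)
pose Y (y : R -> 'rV[R]_n) := (forall t, `|y t - p| <= r) /\
  forall s t, `|y s - y t| <= K * `|s - t|.
pose Phi (y : R -> 'rV[R]_n) t := p + primitive (f \o y) (cl t).
have fyc y : Y y -> continuous (f \o y).
  move=> [yp yK]; apply: (@lipschitz_continuous _ _ _ (L * K)) => s t /=.
  by rewrite (le_trans (fL _ _ _ _))// -mulrA ler_wpM2l.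
have PhiY y : Y y -> Y (Phi y).
  move=> Yy; have [P0 P1] := primitiveP (fyc _ Yy); have [yp _] := Yy.
  have PK s t : `|Phi y s - Phi y t| <= K * `|cl s - cl t|.
    rewrite /Phi opprD addrACA subrr add0r.
    by apply: (mean_value_dist P1) => // u _; exact: fK.
  split => [t|s t]; last by rewrite (le_trans (PK _ _))// ler_wpM2l// clamp_dist.
  have -> : p = Phi y 0 by rewrite /Phi cl0 P0 addr0.
  rewrite (le_trans (PK _ _))// cl0 subr0.
  rewrite (le_trans (ler_wpM2l K0 (le_trans (clT t) TK)))//.
  by rewrite mulrCA ler_piMr ?(ltW r0)// ler_pdivrMr; lra.
have Phi_contr y z d : Y y -> Y z -> (forall t, `|y t - z t| <= d) ->
    forall t, `|Phi y t - Phi z t| <= 2^-1 * d.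
  move=> Yy Yz yz t.
  have d0 : 0 <= d := le_trans (normr_ge0 _) (yz 0).
  have [P0 P1] := primitiveP (fyc _ Yy); have [yp _] := Yy.
  have [Q0 Q1] := primitiveP (fyc _ Yz); have [zp _] := Yz.
  have := @mean_value_dist R 1 n (primitive (f \o y) - primitive (f \o z))
    ((f \o y) - (f \o z)) `]-1, 1[ (L * d) 0 (cl t).
  rewrite /= !fctE P0 Q0 !subr0 /Phi opprD addrACA subrr add0r => H.
  apply: (le_trans (H _ _ _ _)) => //.
  - by move=> u u1; apply: is_deriveB; [exact: P1|exact: Q1].
  - by move=> u _; rewrite (le_trans (fL _ _ _ _))// ler_wpM2l.
  - by rewrite in_itv/=; lra.
  rewrite mulrAC ler_wpM2r// (le_trans (ler_wpM2l L0 (le_trans (clT t) TL)))//.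
  by rewrite ler_pdivrMr; lra.
pose X k := iter k Phi (fun=> p).
have YX k : Y (X k).
  elim: k => [|k]; last exact: PhiY.
  by split => [t|s t]; rewrite subrr normr0 ?(ltW r0)// mulr_ge0.
have XS k t : `|X k.+1 t - X k t| <= r * 2^-1 ^+ k.
  elim: k t => [|k IH] t; first by rewrite expr0 mulr1; exact: (YX 1%N).1.
  by rewrite exprS mulrCA; exact: (Phi_contr _ _ _ (YX k.+1) (YX k) IH).
(* The limit is taken pointwise, but the rate [2 * r * 2^-k] is the same for all [t], so convergence
   is uniform. *)
have [x xP] := choice (fun t => exists_geometric_limit (XS^~ t)).
have Yx : Y x.
  split => [t|s t].
    apply: (@le_geometric _ _ _ (2 * r)) => k.
    rewrite -(subrKA (X k t)) (le_trans (ler_normD _ _))// addrC lerD//.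
      exact: (YX k).1.
    by rewrite distrC.
  apply: (@le_geometric _ _ _ (4 * r)) => k.
  have -> : x s - x t = (X k s - X k t) - ((X k s - x s) - (X k t - x t)).
    by apply/rowP => i; rewrite !mxE; ring.
  rewrite (le_trans (ler_normB _ _))// lerD//; first exact: (YX k).2.
  rewrite (le_trans (ler_normB _ _))//.
  by have := xP s k; have := xP t k; lra.
(* Both [|x - X k.+1|] and [|Phi (X k) - Phi x|] are at most [r * 2^-k]. *)
have xE t : x t = Phi x t.
  apply/eqP; rewrite -subr_eq0 -normr_le0.
  apply: (@le_geometric _ _ _ (2 * r)) => k; rewrite add0r.
  rewrite -(subrKA (X k.+1 t)) (le_trans (ler_normD _ _))//.
  have := xP t k.+1; rewrite distrC exprS.
  have := Phi_contr _ _ _ (YX k) Yx (xP^~ k) t.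
  rewrite -/(X k.+1); lra.
have [P0 P1] := primitiveP (fyc _ Yx).
exists T, x; split => //; first by rewrite xE /Phi cl0 P0 addr0.
move=> s sT.
(* Near an interior time the clamp is the identity, so [x] agrees there with the unclamped
   integral. *)
apply: (@near_eq_is_derive _ _ _ (cst p + primitive (f \o x))).
  near=> t; rewrite xE /Phi cl_id//.
  by near: t; exact: near_in_itvoo.
rewrite -[f _]add0r; apply: is_deriveD; apply: P1.
by rewrite -(cl_id _ sT).
Unshelve. all: by end_near. Qed.

(** * Overflowing invariance *)

Lemma C1_locally_lipschitz (R : realType) n k (f : 'rV[R]_n -> 'rV[R]_k) p :
  C1 f -> exists r L : R, [/\ 0 < r, 0 <= L &
    forall x y, `|x - p| <= r -> `|y - p| <= r -> `|f x - f y| <= L * `|x - y|].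
Proof.
move=> C1f; have [r r0 rP] := C1_strict_differentiable p C1f ltr01.
exists r, (1 + n%:R * `|'J f p|); split => //.
move=> x y xp yp; rewrite -(subrK ((x - y) *m 'J f p) (f x - f y)).
rewrite (le_trans (ler_normD _ _))// mulrDl lerD//; first exact: rP.
by rewrite mulrAC; exact: ler_norm_mulmx.
Qed.

(* Only nonnegative times are available: F vanishes along the trajectory on
   [0, T), so the derivative at 0 is computed from the right. *)
Lemma invariant_vector_field_ker (R : realType) n k (f : 'rV[R]_n -> 'rV[R]_n)
    (F : 'rV[R]_n -> 'rV[R]_k) p :
  C1 f -> C1 F -> invariant_set f (F @^-1` [set 0]) -> F p = 0 ->
  f p *m 'J F p = 0.
Proof.
move=> C1f C1F inv Fp.
have [r [L [r0 L0 fL]]] := C1_locally_lipschitz p C1f.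
have [T [x [T0 x0 xf]]] := picard_lindelof r0 L0 fL.
have Fx s : 0 <= s < T -> F (x s) = 0.
  move=> /andP[s0 sT]; apply: (inv p Fp s) => //.
  exists (- T), T, x; split => //; first by rewrite oppr_lt0 T0.
  by rewrite sT andbT (lt_le_trans _ s0)// oppr_lt0.
have dx : is_derive (0 : R) 1 x (f p).
  by rewrite -x0; apply: xf; rewrite oppr_lt0 T0.
have dFx : is_derive (0 : R) 1 (F \o x) (f p *m 'J F p).
  have [dv dvE] := dx; have /derivable1_diffP dx0 := dv.
  have dF0 : differentiable F (x 0) by exact: C1F.1.
  have dFx0 := differentiable_comp dx0 dF0.
  split; first exact/derivable1_diffP.
  rewrite (deriveE (1 : R) dFx0) (diff_comp dx0 dF0) /=.
  rewrite -(deriveE (1 : R) dx0) dvE -(deriveE (f p) dF0).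
  by rewrite (deriveEjacobian (f p) dF0) x0.
case: dFx => dv <-.
have h : h^-1 *: ((F \o x) (h *: (1 : R) + 0) - (F \o x) 0) @[h --> (0 : R)^'+] -->
    'D_1 (F \o x) 0.
  by apply: cvg_dnbhs_at_right; exact: dv.
(* The right-hand difference quotients are eventually 0, so their limit, the derivative, is 0. *)
apply: (cvg_unique _ h) => //.
apply: cvg_near_cst; near=> s.
rewrite /= [s *: 1]mulr1 addr0 x0 Fp Fx ?subrr ?scaler0//.
by apply/andP; split; near: s; [exact: nbhs_right_ge|exact: nbhs_right_lt].
Unshelve. all: by end_near. Qed.

(* The qualified name avoids the library's [normal_space], which is about
   normal topological spaces. *)
Lemma normal_space_submx (R : realType) n k (F : 'rV[R]_n -> 'rV[R]_k) (p u : 'rV[R]_n) :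
  C1 F -> \rank (Jac F p) = k -> F p = 0 ->
  Defs.normal_space (F @^-1` [set 0]) p u -> (u <= Jac F p)%MS.
Proof.
move=> C1F rk Fp Nu.
have [D DJ] : exists D, D *m 'J F p = 1%:M.
  have : row_full ('J F p) by rewrite /row_full -mxrank_tr -/(Jac F p) rk.
  by move/row_fullP.
rewrite submxE; apply/eqP/matrixP => i j; rewrite !ord1 [RHS]mxE.
(* Columns of the cokernel matrix span the kernel of the Jacobian, hence are tangent; orthogonality
   of [u] to all of them puts [u] in the row space. *)
pose v := (col j (cokermx (Jac F p)))^T.
have vJ : v *m 'J F p = 0.
  apply: trmx_inj; rewrite trmx_mul trmxK trmx0 -/(Jac F p).
  by rewrite colE mulmxA mulmx_coker mul0mx.
rewrite mxE -[RHS](Nu _ (ker_jacobian_tangent C1F DJ Fp vJ)).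
by apply: eq_bigr => l _; rewrite !mxE.
Qed.

Lemma dotE (R : realType) n (u v : 'rV[R]_n) : dot u v = (u *m v^T) 0 0.
Proof. by rewrite mxE; apply: eq_bigr => i _; rewrite mxE. Qed.

Lemma dotZ (R : realType) n (a : R) (u v : 'rV[R]_n) :
  dot (a *: u) (a *: v) = a ^+ 2 * dot u v.
Proof. by rewrite /dot mulr_sumr; apply: eq_bigr => i _; rewrite !mxE mulrACA. Qed.

(** The Jacobian and its transpose define the same quadratic form, since a 1 by 1 matrix equals its
    transpose; this gives the factor 2. *)
Lemma Gamma_quadratic (R : realType) n k (f : 'rV[R]_n -> 'rV[R]_n)
    (F : 'rV[R]_n -> 'rV[R]_k) p w (u := w *m Jac F p) :
  (w *m Gamma f F p *m w^T) 0 0 = 2 * dot (u *m 'J f p) u.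
Proof.
rewrite /Gamma !mulmxA -/u -mulmxA -trmx_mul -/u mulmxDr mulmxDl mxE dotE /Jac trmxK.
have -> : (u *m ('J f p)^T *m u^T) 0 0 = (u *m 'J f p *m u^T) 0 0.
  have -> : u *m 'J f p *m u^T = (u *m ('J f p)^T *m u^T)^T.
    by rewrite !trmx_mul !trmxK mulmxA.
  by rewrite [RHS]mxE.
lra.
Qed.

Lemma dot_jacobian_uniformly_pos (R : realType) n k (f : 'rV[R]_n -> 'rV[R]_n)
    (F : 'rV[R]_n -> 'rV[R]_k) (K : set 'rV[R]_n) :
  C1 f -> C1 F -> compact K -> (forall p, K p -> posdefmx (Gamma f F p)) ->
  exists2 d : R, 0 < d & forall p q (w : 'rV[R]_k), K p -> `|q| <= d -> w != 0 ->
    0 < dot (w *m Jac F p *m 'J f (p + q)) (w *m Jac F p).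
Proof.
move=> C1f C1F cK pd.
pose S := [set w : 'rV[R]_k | `|w| = 1].
have cS : compact S.
  apply: bounded_closed_compact.
    by exists 1; split => // x x1 w /= ->; exact: ltW.
  apply: (@preimage_closed _ _ _ [set x : R | x = 1]) => [w _|]; first exact: norm_continuous.
  exact: closed_eq.
pose phi (x : ('rV[R]_n * 'rV[R]_k) * 'rV[R]_n) : R :=
  ((x.1.2 *m Jac F x.1.1 *m 'J f (x.1.1 + x.2)) *m (x.1.2 *m Jac F x.1.1)^T) 0 0.
have cphi x : {for x, continuous phi}.
  have c0 : y.1 @[y --> x] --> x.1 by exact: cvg_fst.
  have c1 : y.1.1 @[y --> x] --> x.1.1.
    by apply: (cvg_comp _ _ c0); exact: cvg_fst.
  have c2 : y.1.2 @[y --> x] --> x.1.2.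
    by apply: (cvg_comp _ _ c0); exact: cvg_snd.
  have cu : y.1.2 *m Jac F y.1.1 @[y --> x] --> x.1.2 *m Jac F x.1.1.
    by apply: cvg_mulmx => //; apply: continuous_cvg c1; exact: C1F.2.
  have cJ : 'J f (y.1.1 + y.2) @[y --> x] --> 'J f (x.1.1 + x.2).
    have cs : y.1.1 + y.2 @[y --> x] --> x.1.1 + x.2.
      by apply: cvgD c1 _; exact: cvg_snd.
    exact: (continuous_cvg _ (C1_continuous_jacobian C1f (x := _)) cs).
  by apply: cvg_coord; apply: cvg_mulmx; [exact: cvg_mulmx|exact: cvg_trmx].
have /compact_near_coveringP cov := compact_setX cK cS.
(* Compactness in its near-covering form turns positivity of the continuous [phi] at each
   [((p, w), 0)] into one neighbourhood of [q = 0] valid for all [(p, w)]. *)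
have /nbhs_ballP[d /= d0 dP] : \forall q \near (0 : 'rV[R]_n),
    K `*` S `<=` (fun x => 0 < phi (x, q)).
  apply: (cov _ (nbhs (0 : 'rV[R]_n)) (fun q x => 0 < phi (x, q)) _) => -[p w] [/= Kp Sw].
  have phi0 : 0 < phi ((p, w), 0).
    rewrite /phi/= addr0 -dotE.
    have w0 : w != 0 by rewrite -normr_gt0 Sw.
    by have := (pd _ Kp).2 _ w0; rewrite Gamma_quadratic pmulr_rgt0.
  exact: (cvgr_gt _ (cphi ((p, w), 0)) _ phi0).
exists (d / 2); first by rewrite divr_gt0.
move=> p q w Kp qd w0.
have nw : 0 < `|w| by rewrite normr_gt0.
(* Normalising [w] scales the pairing by the positive factor [|w|^-2]. *)
have : 0 < phi ((p, `|w|^-1 *: w), q).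
  have qb : ball (0 : 'rV[R]_n) d q.
    by rewrite -ball_normE/= sub0r normrN (le_lt_trans qd)//; lra.
  apply: (dP q qb); split => //=.
  by rewrite /S/= normrZ normfV normr_id mulVf// gt_eqF.
rewrite /phi/= -dotE -!scalemxAl dotZ pmulr_rgt0//.
by rewrite exprn_gt0// invr_gt0.
Qed.

Theorem mainTheorem1 (R : realType) (n m : nat) (hmn : (m <= n)%N)
    (f : 'rV[R]_n -> 'rV[R]_n) (hf : C2 f)
    (F : 'rV[R]_n -> 'rV[R]_(n - m)) (hF : C1 F)
    (M : set 'rV[R]_n) (hM : M = F @^-1` [set 0])
    (hrank : forall p, M p -> \rank (Jac F p) = (n - m)%N)
    (hinv : invariant_set f M)
    (Omega : set 'rV[R]_n) (hOmega : compact Omega)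
    (hMOmega : compact (M `&` Omega)) (hne : M `&` Omega !=set0)
    (hGamma : forall p, (M `&` Omega) p -> posdefmx (Gamma f F p)) :
  exists eps0 : R, 0 < eps0 /\
    forall eps : R, 0 < eps <= eps0 -> overflowing_invariant f M Omega eps.
Proof.
have [C1f _] := hf.
have [d d0 dP] := dot_jacobian_uniformly_pos C1f hF hMOmega hGamma.
exists d; split => // e /andP[e0 ed] p Kp u Nu u1.
have Mp := Kp.1; have Fp : F p = 0 by rewrite hM in Mp.
have /submxP[w uw] : (u <= Jac F p)%MS.
  by apply: normal_space_submx => //; [exact: hrank|rewrite -hM].
have u0 : u != 0.
  apply: contra_eq_neq u1 => ->; rewrite /enorm /dot big1 ?sqrtr0 1?eq_sym ?oner_eq0//.
  by move=> i _; rewrite mxE mul0r.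
have w0 : w != 0 by apply: contraNneq u0 => w0; rewrite uw w0 mul0mx.
(* The sup norm is at most the Euclidean norm, so [|c u| <= c < e <= d] places the intermediate
   point within the uniform radius. *)
have ui : `|u| <= 1.
  apply: ler_mx_norm => // i j; rewrite ord1 -u1 /enorm -sqrtr_sqr ler_sqrt.
    by rewrite /dot (bigD1 j)//= expr2 lerDl sumr_ge0// => l _; rewrite -expr2 sqr_ge0.
  by rewrite sumr_ge0// => l _; rewrite -expr2 sqr_ge0.
(* Writing [u] as [w *m Jac F p] turns this pairing into [f p *m 'J F p] applied to [w^T], which
   vanishes by invariance. *)
have fu : dot (f p) u = 0.
  rewrite dotE uw trmx_mul mulmxA /Jac trmxK.
  rewrite invariant_vector_field_ker ?mul0mx ?mxE//.
  by rewrite -hM.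
pose g (s : R) : R := (f (p + s *: u) *m u^T) 0 0.
pose dg (s : R) : R := (u *m 'J f (p + s *: u) *m u^T) 0 0.
have gd (s : R) : is_derive s 1 g (dg s).
  have df : is_derive s 1 (fun t => f (p + t *: u)) (u *m 'J f (p + s *: u)).
    by apply: is_derive_line; exact: C1f.1.
  exact: (is_derive_coord 0 0 (is_derive_mulmxr u^T df)).
have cg : {within `[0, e], continuous g}.
  by apply: continuous_subspaceT => s; exact: is_derive_continuous.
have [c + E] := MVT e0 (fun s _ => gd s) cg.
rewrite in_itv/= => /andP[c0 ce].
have g0 : g 0 = 0 by rewrite /g scale0r addr0 -dotE.
rewrite g0 !subr0 in E.
rewrite dotE -/(g e) E mulr_gt0// /dg -dotE uw; apply: dP => //.
rewrite -uw normrZ (ger0_norm (ltW c0)).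
rewrite (le_trans _ ed)// (le_trans _ (ltW ce))//.
by rewrite ler_piMr// ltW.
Qed.
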